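(* Assume Church's thesis $\mathsf{CT_Q}$ and Markov's principle $\mathsf{MP}$. Let $\mathcal{M}$ be a model of $\mathsf{HA}$ whose domain is discrete. If the domain of $\mathcal{M}$ is enumerable, then $\mathcal{M} \cong \mathbb{N}$.
   Context: Meta-theory: constructive type theory (Calculus of Inductive Constructions); propositions live in an impredicative universe $\mathbb{P}$, and $\exists,\lor$ are propositional; no classical axioms are assumed unless stated. Markov's principle $\mathsf{MP}$: for every $f:\mathbb{N}\to\mathbb{N}$, $\neg\neg(\exists n.\, f\,n=0)\to \exists n.\, f\,n=0$. A type $X$ is discrete if there is $f:X\to X\to\mathbb{B}$ with $x=y \leftrightarrow f\,x\,y=\mathsf{tt}$ for all $x,y$; it is enumerable if there is $g:\mathbb{N}\to\mathcal{O}(X)$ (option type) with $\forall x.\,\exists n.\, g\,n=\mathsf{Some}\,x$. First-order arithmetic has signature $0,S,+,\times,=$. $\mathsf{HA}$ consists of the axioms $\forall x.\, Sx=0\to\bot$; $\forall xy.\, Sx=Sy\to x=y$; $\forall x.\,0+x=x$; $\forall xy.\,(Sx)+y=S(x+y)$; $\forall x.\,0\times x=0$; $\forall xy.\,(Sx)\times y=y+x\times y$; reflexivity, symmetry, transitivity of $=$ and congruence of $=$ for $S,+,\times$; and the induction scheme $\varphi(0)\to(\forall x.\varphi(x)\to\varphi(Sx))\to\forall x.\varphi(x)$ for every formula $\varphi$. Robinson arithmetic $\mathsf{Q}$ has the same axioms but with the induction scheme replaced by $\forall x.\, x=0\lor\exists y.\, x=Sy$. $\vdash$ is intuitionistic natural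 deduction. A model $\mathcal{M}$ of $\mathsf{HA}$ is a type (also denoted $\mathcal{M}$) with functions interpreting $0,S,+,\times$, in which $=$ is interpreted as the actual equality of the type, satisfying all $\mathsf{HA}$ axioms under Tarski semantics (connectives and quantifiers are interpreted by the corresponding type-theoretic ones). Numerals: $\overline{n}$ is the term $S^n 0$; its value in $\mathcal{M}$ is also written $\overline{n}$. $\mathcal{M}\cong\mathbb{N}$ means there is a bijective homomorphism $\mathbb{N}\to\mathcal{M}$. A formula $\varphi$ is $\Delta_1$ if for every substitution $\sigma$ of closed terms, $\mathsf{Q}\vdash\varphi[\sigma]$ or $\mathsf{Q}\vdash\neg\varphi[\sigma]$; it is $\Sigma_1$ if of the form $\exists x_1\dots\exists x_n.\varphi_0$ with $\varphi_0$ a $\Delta_1$ formula. $\mathsf{CT_Q}$: for every function $f:\mathbb{N}\to\mathbb{N}$ there is a binary $\Sigma_1$-formula $\varphi_f(x,y)$ such that for every $n$, $\mathsf{Q}\vdash\forall y.\,\varphi_f(\overline{n},y)\leftrightarrow \overline{f\,n}=y$. *)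

(* Defs.v *)
From Stdlib Require Import List FinFun.

Set Implicit Arguments.
Unset Strict Implicit.

(** * Syntax of first-order arithmetic, with de Bruijn indices *)

Inductive term : Type :=
| var  : nat -> term
| Zero : term
| Succ : term -> term
| Plus : term -> term -> term
| Mult : term -> term -> term.

Inductive form : Type :=
| Bot : form
| Eq  : term -> term -> form
| Imp : form -> form -> form
| And : form -> form -> form
| Or  : form -> form -> form
| All : form -> form
| Ex  : form -> form.

Definition Neg (phi : form) : form := Imp phi Bot.
Definition Iff (phi psi : form) : form := And (Imp phi psi) (Imp psi phi).

Fixpoint num (n : nat) : term :=
  match n with
  | O => Zero
  | S n => Succ (num n)
  end.

(** * Substitution *)

Definition scons {X : Type} (x : X) (sigma : nat -> X) (n : nat) : X :=
  match n with
  | O => x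
  | S n => sigma n
  end.

Fixpoint subst_term (sigma : nat -> term) (t : term) : term :=
  match t with
  | var n => sigma n
  | Zero => Zero
  | Succ s => Succ (subst_term sigma s)
  | Plus s u => Plus (subst_term sigma s) (subst_term sigma u)
  | Mult s u => Mult (subst_term sigma s) (subst_term sigma u)
  end.

Definition shift : nat -> term := fun n => var (S n).

Definition up (sigma : nat -> term) : nat -> term :=
  scons (var 0) (fun n => subst_term shift (sigma n)).

Fixpoint subst_form (sigma : nat -> term) (phi : form) : form :=
  match phi with
  | Bot => Bot
  | Eq s t => Eq (subst_term sigma s) (subst_term sigma t)
  | Imp phi psi => Imp (subst_form sigma phi) (subst_form sigma psi)
  | And phi psi => And (subst_form sigma phi) (subst_form sigma psi)
  | Or phi psi => Or (subst_form sigma phi) (subst_form sigma psi)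
  | All phi => All (subst_form (up sigma) phi)
  | Ex phi => Ex (subst_form (up sigma) phi)
  end.

(** [inst t phi] replaces index 0 by [t] and lowers all other indices. *)
Definition inst (t : term) (phi : form) : form := subst_form (scons t var) phi.

(** [bounded_term k t] and [bounded k phi]: all free indices are below [k]. *)

Fixpoint bounded_term (k : nat) (t : term) : Prop :=
  match t with
  | var n => n < k
  | Zero => True
  | Succ s => bounded_term k s
  | Plus s u | Mult s u => bounded_term k s /\ bounded_term k u
  end.

Fixpoint bounded (k : nat) (phi : form) : Prop :=
  match phi with
  | Bot => True
  | Eq s t => bounded_term k s /\ bounded_term k t
  | Imp phi psi | And phi psi | Or phi psi => bounded k phi /\ bounded k psi
  | All phi | Ex phi => bounded (S k) phi
  end.

Definition closed_term (t : term) : Prop := bounded_term 0 t.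

(** * Intuitionistic natural deduction *)

Inductive prv : list form -> form -> Prop :=
| Ctx Gamma phi : In phi Gamma -> prv Gamma phi
| Exp Gamma phi : prv Gamma Bot -> prv Gamma phi
| ImpI Gamma phi psi : prv (phi :: Gamma) psi -> prv Gamma (Imp phi psi)
| ImpE Gamma phi psi : prv Gamma (Imp phi psi) -> prv Gamma phi -> prv Gamma psi
| AndI Gamma phi psi : prv Gamma phi -> prv Gamma psi -> prv Gamma (And phi psi)
| AndE1 Gamma phi psi : prv Gamma (And phi psi) -> prv Gamma phi
| AndE2 Gamma phi psi : prv Gamma (And phi psi) -> prv Gamma psi
| OrI1 Gamma phi psi : prv Gamma phi -> prv Gamma (Or phi psi)
| OrI2 Gamma phi psi : prv Gamma psi -> prv Gamma (Or phi psi)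
| OrE Gamma phi psi theta :
    prv Gamma (Or phi psi) ->
    prv (phi :: Gamma) theta -> prv (psi :: Gamma) theta ->
    prv Gamma theta
| AllI Gamma phi : prv (map (subst_form shift) Gamma) phi -> prv Gamma (All phi)
| AllE Gamma phi t : prv Gamma (All phi) -> prv Gamma (inst t phi)
| ExI Gamma phi t : prv Gamma (inst t phi) -> prv Gamma (Ex phi)
| ExE Gamma phi psi :
    prv Gamma (Ex phi) ->
    prv (phi :: map (subst_form shift) Gamma) (subst_form shift psi) ->
    prv Gamma psi.

(** * Axioms *)

Definition ax_succ_ne_zero : form := All (Imp (Eq (Succ (var 0)) Zero) Bot).
Definition ax_succ_inj : form :=
  All (All (Imp (Eq (Succ (var 1)) (Succ (var 0))) (Eq (var 1) (var 0)))).
Definition ax_add_zero : form := All (Eq (Plus Zero (var 0)) (var 0)).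
Definition ax_add_succ : form :=
  All (All (Eq (Plus (Succ (var 1)) (var 0)) (Succ (Plus (var 1) (var 0))))).
Definition ax_mult_zero : form := All (Eq (Mult Zero (var 0)) Zero).
Definition ax_mult_succ : form :=
  All (All (Eq (Mult (Succ (var 1)) (var 0))
               (Plus (var 0) (Mult (var 1) (var 0))))).

Definition ax_refl : form := All (Eq (var 0) (var 0)).
Definition ax_sym : form :=
  All (All (Imp (Eq (var 1) (var 0)) (Eq (var 0) (var 1)))).
Definition ax_trans : form :=
  All (All (All (Imp (Eq (var 2) (var 1))
                (Imp (Eq (var 1) (var 0)) (Eq (var 2) (var 0)))))).
Definition ax_succ_congr : form :=
  All (All (Imp (Eq (var 1) (var 0)) (Eq (Succ (var 1)) (Succ (var 0))))).
Definition ax_add_congr : form :=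
  All (All (All (All (Imp (Eq (var 3) (var 2)) (Imp (Eq (var 1) (var 0))
    (Eq (Plus (var 3) (var 1)) (Plus (var 2) (var 0)))))))).
Definition ax_mult_congr : form :=
  All (All (All (All (Imp (Eq (var 3) (var 2)) (Imp (Eq (var 1) (var 0))
    (Eq (Mult (var 3) (var 1)) (Mult (var 2) (var 0)))))))).

Definition base_axioms : list form :=
  ax_succ_ne_zero :: ax_succ_inj ::
  ax_add_zero :: ax_add_succ :: ax_mult_zero :: ax_mult_succ ::
  ax_refl :: ax_sym :: ax_trans ::
  ax_succ_congr :: ax_add_congr :: ax_mult_congr :: nil.

Definition ax_cases : form :=
  All (Or (Eq (var 0) Zero) (Ex (Eq (var 1) (Succ (var 0))))).

Definition Q : list form := ax_cases :: base_axioms.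

(** The induction variable is index 0 of [phi]; the other free indices are
    parameters. *)
Definition ax_induction (phi : form) : form :=
  Imp (inst Zero phi)
 (Imp (All (Imp phi (subst_form (scons (Succ (var 0)) shift) phi)))
      (All phi)).

Inductive HA : form -> Prop :=
| HA_base phi : In phi base_axioms -> HA phi
| HA_induction phi : HA (ax_induction phi).

(** * Tarski semantics, with [Eq] interpreted as equality of the domain *)

Record structure : Type := {
  domain :> Type;
  i_zero : domain;
  i_succ : domain -> domain;
  i_plus : domain -> domain -> domain;
  i_mult : domain -> domain -> domain
}.

Fixpoint eval (M : structure) (rho : nat -> M) (t : term) : M :=
  match t with
  | var n => rho n
  | Zero => i_zero M
  | Succ s => i_succ (eval rho s)
  | Plus s u => i_plus (eval rho s) (eval rho u)
  | Mult s u => i_mult (eval rho s) (eval rho u)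
  end.

Fixpoint sat (M : structure) (rho : nat -> M) (phi : form) : Prop :=
  match phi with
  | Bot => False
  | Eq s t => eval rho s = eval rho t
  | Imp phi psi => sat rho phi -> sat rho psi
  | And phi psi => sat rho phi /\ sat rho psi
  | Or phi psi => sat rho phi \/ sat rho psi
  | All phi => forall d : M, sat (scons d rho) phi
  | Ex phi => exists d : M, sat (scons d rho) phi
  end.

Definition model_of_HA (M : structure) : Prop :=
  forall (phi : form) (rho : nat -> M), HA phi -> sat rho phi.

Definition homomorphism_from_nat (M : structure) (h : nat -> M) : Prop :=
  h 0 = i_zero M /\
  (forall n, h (S n) = i_succ (h n)) /\
  (forall n m, h (n + m) = i_plus (h n) (h m)) /\
  (forall n m, h (n * m) = i_mult (h n) (h m)).

Definition iso_nat (M : structure) : Prop :=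
  exists h : nat -> M,
    homomorphism_from_nat h /\ Injective h /\ Surjective h.

Definition discrete (X : Type) : Prop :=
  exists f : X -> X -> bool, forall x y, x = y <-> f x y = true.

Definition enumerable (X : Type) : Prop :=
  exists g : nat -> option X, forall x, exists n, g n = Some x.

(** * Church's thesis for Robinson arithmetic, and Markov's principle *)

Definition Delta1 (phi : form) : Prop :=
  forall sigma : nat -> term, (forall n, closed_term (sigma n)) ->
    prv Q (subst_form sigma phi) \/ prv Q (Neg (subst_form sigma phi)).

Definition Sigma1 (phi : form) : Prop :=
  exists (n : nat) (phi0 : form), Delta1 phi0 /\ phi = Nat.iter n Ex phi0.

(** In the binary formula [phi] the argument [x] is index 0 and the value [y]
    is index 1, so that [y] has become index 0 in [inst (num n) phi]. *)
Definition CT_Q : Prop :=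
  forall f : nat -> nat, exists phi : form,
    bounded 2 phi /\ Sigma1 phi /\
    forall n, prv Q (All (Iff (inst (num n) phi) (Eq (num (f n)) (var 0)))).

Definition MP : Prop :=
  forall f : nat -> nat, ~ ~ (exists n, f n = 0) -> exists n, f n = 0.

(* Main.v *)
(** Suppose [e] is a nonstandard element of [M].  For every formula [P], HA
    proves by induction on [k] that not not there is [c] such that [P i] is
    equivalent to [1 + (i+1) m] dividing [c] for all [i < k], where [m] is
    divisible by the relevant indices, as for Goedel's beta function.  At [k = e]
    this covers all standard [i], so by Church's thesis every
    [D : nat -> bool] is not not coded by a pair [(m, c)].  Since [M] is discrete
    and enumerable, division with remainder makes divisibility in [M]
    decidable, and the diagonal predicate along an enumeration of the pairs
    is a [D] without a code.  Hence no element is nonstandard, and Markov's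
    principle turns this into standardness. *)
Require Import Defs.
From Stdlib Require Import List FinFun Ring Cantor ConstructiveEpsilon.

Set Implicit Arguments.
Unset Strict Implicit.

(** * Soundness of natural deduction *)

Lemma eval_ext (M : structure) (rho rho' : nat -> M) (t : term) :
  (forall n, rho n = rho' n) -> eval rho t = eval rho' t.
Proof.
  intros H; induction t; cbn; congruence.
Qed.

Lemma scons_ext (X : Type) (x : X) (f g : nat -> X) :
  (forall n, f n = g n) -> forall n, scons x f n = scons x g n.
Proof.
  intros H [|n]; cbn; auto.
Qed.

Lemma sat_ext (M : structure) (phi : form) (rho rho' : nat -> M) :
  (forall n, rho n = rho' n) -> sat rho phi <-> sat rho' phi.
Proof.
  revert rho rho'.
  induction phi as [|s t|p IHp q IHq|p IHp q IHq|p IHp q IHq|p IHp|p IHp];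
    intros rho rho' H; cbn.
  1: reflexivity.
  1: now rewrite (eval_ext s H), (eval_ext t H).
  1-3: specialize (IHp _ _ H); specialize (IHq _ _ H); tauto.
  - split; intros Hall d; generalize (Hall d); apply IHp; intros n;
      apply scons_ext; congruence.
  - split; intros [d Hd]; exists d; revert Hd; apply IHp; intros n;
      apply scons_ext; congruence.
Qed.

Lemma eval_subst (M : structure) (rho : nat -> M) (sigma : nat -> term) (t : term) :
  eval rho (subst_term sigma t) = eval (fun n => eval rho (sigma n)) t.
Proof.
  induction t; cbn; congruence.
Qed.

Lemma eval_up (M : structure) (rho : nat -> M) (sigma : nat -> term) (d : M) (n : nat) :
  eval (scons d rho) (up sigma n) = scons d (fun k => eval rho (sigma k)) n.
Proof.
  destruct n as [|n]; cbn; [reflexivity|].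
  rewrite eval_subst. now apply eval_ext.
Qed.

Lemma sat_subst (M : structure) (phi : form) (rho : nat -> M) (sigma : nat -> term) :
  sat rho (subst_form sigma phi) <-> sat (fun n => eval rho (sigma n)) phi.
Proof.
  revert rho sigma.
  induction phi as [|s t|p IHp q IHq|p IHp q IHq|p IHp q IHq|p IHp|p IHp];
    intros rho sigma; cbn.
  1: reflexivity.
  1: now rewrite !eval_subst.
  1-3: specialize (IHp rho sigma); specialize (IHq rho sigma); tauto.
  - split; intros Hall d; generalize (Hall d); rewrite IHp; apply sat_ext;
      intros n; now rewrite eval_up.
  - split; intros [d Hd]; exists d; revert Hd; rewrite IHp; apply sat_ext;
      intros n; now rewrite eval_up.
Qed.

Lemma sat_inst (M : structure) (rho : nat -> M) (t : term) (phi : form) :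
  sat rho (inst t phi) <-> sat (scons (eval rho t) rho) phi.
Proof.
  unfold inst. rewrite sat_subst. apply sat_ext. now intros [|n].
Qed.

Lemma sat_shift (M : structure) (rho : nat -> M) (d : M) (phi : form) :
  sat (scons d rho) (subst_form shift phi) <-> sat rho phi.
Proof.
  rewrite sat_subst. now apply sat_ext.
Qed.

(** Carries the [Q]-derivations supplied by [CT_Q] into the model. *)
Lemma soundness (M : structure) (Gamma : list form) (phi : form) :
  prv Gamma phi ->
  forall rho : nat -> M, (forall psi, In psi Gamma -> sat rho psi) -> sat rho phi.
Proof.
  assert (Hcons : forall (rho : nat -> M) p G,
    sat rho p -> (forall psi, In psi G -> sat rho psi) ->
    forall psi, In psi (p :: G) -> sat rho psi).
  { intros rho p G Hp HG psi [<-|Hin]; auto. }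
  assert (Hshift : forall (rho : nat -> M) d G,
    (forall psi, In psi G -> sat rho psi) ->
    forall psi, In psi (map (subst_form shift) G) -> sat (scons d rho) psi).
  { intros rho d G HG psi (p & <- & Hin)%in_map_iff. apply sat_shift. auto. }
  induction 1 as [| | |G p q _ IH1 _ IH2| |G p q _ IH|G p q _ IH| |
    |G p q r _ IH _ IH1 _ IH2| |G p t _ IH|G p t _ IH|G p q _ IH1 _ IH2];
    intros rho HG; cbn [sat] in *.
  - auto.
  - destruct (IHprv rho HG).
  - intros Hp. apply IHprv, Hcons; assumption.
  - exact (IH1 rho HG (IH2 rho HG)).
  - auto.
  - apply (IH rho HG).
  - apply (IH rho HG).
  - auto.
  - auto.
  - destruct (IH rho HG) as [Hp|Hq]; [apply IH1|apply IH2]; apply Hcons; assumption.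
  - intros d. apply IHprv, Hshift, HG.
  - apply sat_inst. apply (IH rho HG).
  - exists (eval rho t). apply sat_inst, (IH rho HG).
  - destruct (IH1 rho HG) as [d Hd].
    apply (sat_shift rho d), IH2, Hcons; [exact Hd | apply Hshift, HG].
Qed.

(** * Arithmetic in a model of HA *)

Section Model.

Context (M : structure) (hHA : model_of_HA M).

Local Notation "0" := (i_zero M).
Local Notation "1" := (i_succ (i_zero M)).
Local Notation "x + y" := (i_plus x y).
Local Notation "x * y" := (i_mult x y).

Implicit Types x y z a b c d e i j k l m p q r s t u w : M.

Let env0 : nat -> M := fun _ => 0.

(** Induction holds only for definable predicates, so each use names a formula whose parameters
    start at index 1. *)
Lemma model_induction (phi : form) (rho : nat -> M) :
  sat (scons 0 rho) phi ->
  (forall x, sat (scons x rho) phi -> sat (scons (i_succ x) rho) phi) ->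
  forall x, sat (scons x rho) phi.
Proof.
  intros H0 HS. apply (hHA rho (HA_induction phi)).
  - now apply sat_inst.
  - intros x Hx. apply sat_subst.
    generalize (HS x Hx). apply sat_ext. now intros [|n].
Qed.

Lemma base_axiom (phi : form) : In phi base_axioms -> sat env0 phi.
Proof.
  intros H. now apply hHA, HA_base.
Qed.

Ltac base ax := refine (@base_axiom ax _); repeat first [left; reflexivity | right].

Lemma succ_ne_zero x : i_succ x <> 0.
Proof. revert x. base ax_succ_ne_zero. Qed.

Lemma succ_inj x y : i_succ x = i_succ y -> x = y.
Proof. revert x y. base ax_succ_inj. Qed.

Lemma add_zero_l x : 0 + x = x.
Proof. revert x. base ax_add_zero. Qed.

Lemma add_succ_l x y : i_succ x + y = i_succ (x + y).
Proof. revert x y. base ax_add_succ. Qed.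

Lemma mul_zero_l x : 0 * x = 0.
Proof. revert x. base ax_mult_zero. Qed.

Lemma mul_succ_l x y : i_succ x * y = y + x * y.
Proof. revert x y. base ax_mult_succ. Qed.

(** The case axiom of [Q], which HA obtains by induction; [sat_Q] relies on it. *)
Lemma zero_or_succ x : x = 0 \/ exists y, x = i_succ y.
Proof.
  revert x.
  apply (@model_induction (Or (Eq (var 0) Zero) (Ex (Eq (var 1) (Succ (var 0))))) env0);
    cbn; eauto.
Qed.

Lemma add_zero_r x : x + 0 = x.
Proof.
  revert x. apply (@model_induction (Eq (Plus (var 0) Zero) (var 0)) env0); cbn.
  - apply add_zero_l.
  - intros x IH. now rewrite add_succ_l, IH.
Qed.

Lemma add_succ_r x y : x + i_succ y = i_succ (x + y).
Proof.
  revert x.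
  apply (@model_induction (Eq (Plus (var 0) (Succ (var 1))) (Succ (Plus (var 0) (var 1))))
           (scons y env0)); cbn.
  - now rewrite !add_zero_l.
  - intros x IH. now rewrite !add_succ_l, IH.
Qed.

Lemma add_comm x y : x + y = y + x.
Proof.
  revert x.
  apply (@model_induction (Eq (Plus (var 0) (var 1)) (Plus (var 1) (var 0)))
           (scons y env0)); cbn.
  - now rewrite add_zero_l, add_zero_r.
  - intros x IH. now rewrite add_succ_l, add_succ_r, IH.
Qed.

Lemma add_assoc x y z : x + (y + z) = (x + y) + z.
Proof.
  revert x.
  apply (@model_induction
           (Eq (Plus (var 0) (Plus (var 1) (var 2))) (Plus (Plus (var 0) (var 1)) (var 2)))
           (scons y (scons z env0))); cbn.
  - now rewrite !add_zero_l.
  - intros x IH. now rewrite !add_succ_l, IH.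
Qed.

Lemma mul_zero_r x : x * 0 = 0.
Proof.
  revert x. apply (@model_induction (Eq (Mult (var 0) Zero) Zero) env0); cbn.
  - apply mul_zero_l.
  - intros x IH. now rewrite mul_succ_l, IH, add_zero_l.
Qed.

Lemma mul_succ_r x y : x * i_succ y = x + x * y.
Proof.
  revert x.
  apply (@model_induction
           (Eq (Mult (var 0) (Succ (var 1))) (Plus (var 0) (Mult (var 0) (var 1))))
           (scons y env0)); cbn.
  - now rewrite !mul_zero_l, add_zero_l.
  - intros x IH. rewrite !mul_succ_l, IH, !add_succ_l. f_equal.
    now rewrite !add_assoc, (add_comm y x).
Qed.

Lemma mul_comm x y : x * y = y * x.
Proof.
  revert x.
  apply (@model_induction (Eq (Mult (var 0) (var 1)) (Mult (var 1) (var 0)))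
           (scons y env0)); cbn.
  - now rewrite mul_zero_l, mul_zero_r.
  - intros x IH. now rewrite mul_succ_l, mul_succ_r, IH.
Qed.

Lemma mul_add_l x y z : (x + y) * z = x * z + y * z.
Proof.
  revert x.
  apply (@model_induction
           (Eq (Mult (Plus (var 0) (var 1)) (var 2))
               (Plus (Mult (var 0) (var 2)) (Mult (var 1) (var 2))))
           (scons y (scons z env0))); cbn.
  - now rewrite mul_zero_l, !add_zero_l.
  - intros x IH. now rewrite add_succ_l, !mul_succ_l, IH, add_assoc.
Qed.

Lemma mul_assoc x y z : x * (y * z) = (x * y) * z.
Proof.
  revert x.
  apply (@model_induction
           (Eq (Mult (var 0) (Mult (var 1) (var 2))) (Mult (Mult (var 0) (var 1)) (var 2)))
           (scons y (scons z env0))); cbn.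
  - now rewrite !mul_zero_l.
  - intros x IH. now rewrite !mul_succ_l, mul_add_l, IH.
Qed.

Lemma succ_eq x : i_succ x = 1 + x.
Proof. now rewrite add_succ_l, add_zero_l. Qed.

Lemma model_semi_ring : semi_ring_theory 0 1 (@i_plus M) (@i_mult M) (@eq M).
Proof.
  split.
  - apply add_zero_l.
  - apply add_comm.
  - apply add_assoc.
  - intros x. now rewrite mul_succ_l, mul_zero_l, add_zero_r.
  - apply mul_zero_l.
  - apply mul_comm.
  - apply mul_assoc.
  - apply mul_add_l.
Qed.

Add Ring model_ring : model_semi_ring.

(** * Cancellation, order and division with remainder *)

Lemma add_cancel_l x y z : x + y = x + z -> y = z.
Proof.
  revert x.
  apply (@model_induction
           (Imp (Eq (Plus (var 0) (var 1)) (Plus (var 0) (var 2))) (Eq (var 1) (var 2)))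
           (scons y (scons z env0))); cbn.
  - now rewrite !add_zero_l.
  - intros x IH. rewrite !add_succ_l. intros H%succ_inj. auto.
Qed.

Lemma add_eq_zero_r x y : x + y = 0 -> y = 0.
Proof.
  destruct (zero_or_succ x) as [->|[x' ->]].
  - now rewrite add_zero_l.
  - rewrite add_succ_l. now intros []%succ_ne_zero.
Qed.

Lemma ne_add_succ x y : x <> x + i_succ y.
Proof.
  intros H. apply (@succ_ne_zero y), (@add_cancel_l x).
  now rewrite add_zero_r.
Qed.

(** The language has no order symbol: throughout, [x = y + s] expresses that [y] is at most [x], and
    [k = i_succ (i + s)] that [i] is below [k]. *)
Lemma le_total x y : exists s, x = y + s \/ y = x + s.
Proof.
  revert x.
  apply (@model_induction
           (Ex (Or (Eq (var 1) (Plus (var 2) (var 0))) (Eq (var 2) (Plus (var 1) (var 0)))))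
           (scons y env0)); cbn.
  - exists y. right. now rewrite add_zero_l.
  - intros x [s [H|H]].
    + exists (i_succ s). left. now rewrite add_succ_r, <- H.
    + destruct (zero_or_succ s) as [->|[s' ->]].
      * exists 1. left. rewrite H, (succ_eq x). ring.
      * exists s'. right. now rewrite H, add_succ_r, add_succ_l.
Qed.

Definition divides (d c : M) : Prop := exists q, c = d * q.

Lemma divides_mul_r d a b : divides d a -> divides d (a * b).
Proof.
  intros [q ->]. exists (q * b). ring.
Qed.

(** With [a = d * p] and [a + b = d * q], the quotient of [b] is the difference of [q] and [p] if
    [q] is the larger; otherwise [b] is forced to be 0. *)
Lemma divides_add_cancel d a b : divides d (a + b) -> divides d a -> divides d b.
Proof.
  intros [q Hq] [p ->]. destruct (le_total q p) as [s [->| ->]].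
  - exists s. apply (@add_cancel_l (d * p)). rewrite Hq. ring.
  - exists 0. rewrite mul_zero_r. apply (@add_eq_zero_r (d * s)).
    apply (@add_cancel_l (d * q)).
    transitivity (d * (q + s) + b); [ring|]. rewrite Hq. ring.
Qed.

(** A nonzero multiple of [d] is at least [d], which exceeds [r]. *)
Lemma divides_lt d r s : d = i_succ (r + s) -> divides d r -> r = 0.
Proof.
  intros Hd [q Hq]. destruct (zero_or_succ q) as [->|[p ->]].
  - now rewrite mul_zero_r in Hq.
  - exfalso. apply (@ne_add_succ r (s + d * p)).
    rewrite Hq at 1. rewrite mul_succ_r.
    rewrite Hd at 1. rewrite (succ_eq (r + s)), (succ_eq (s + d * p)). ring.
Qed.

Lemma division p c : exists q r s, c = i_succ p * q + r /\ i_succ p = i_succ (r + s).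
Proof.
  revert c.
  apply (@model_induction
           (Ex (Ex (Ex (And
              (Eq (var 3) (Plus (Mult (Succ (var 4)) (var 2)) (var 1)))
              (Eq (Succ (var 4)) (Succ (Plus (var 1) (var 0))))))))
           (scons p env0)); cbn.
  - exists 0, 0, p. split; [ring | now rewrite add_zero_l].
  - intros c (q & r & s & -> & Hs). destruct (zero_or_succ s) as [->|[s' ->]].
    (* Here [r = p] is the largest remainder, so it wraps to 0 and the quotient grows. *)
    + rewrite add_zero_r in Hs. apply succ_inj in Hs. subst r.
      exists (i_succ q), 0, p. split; [|now rewrite add_zero_l].
      rewrite (succ_eq (_ + _)), (succ_eq p), (succ_eq q). ring.
    + exists q, (i_succ r), s'. split.
      * now rewrite add_succ_r.
      * now rewrite Hs, add_succ_r, add_succ_l.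
Qed.

(** * Coding definable predicates *)

(* This form of coprimality is preserved by products in the second argument
   without an appeal to Bezout coefficients. *)
Definition coprime (d c : M) : Prop := forall z, divides d (c * z) -> divides d z.

Lemma coprime_one d : coprime d 1.
Proof.
  intros z. now replace (1 * z) with z by ring.
Qed.

Lemma coprime_mul d a b : coprime d a -> coprime d b -> coprime d (a * b).
Proof.
  intros Ha Hb z H. apply Hb, Ha. now rewrite mul_assoc.
Qed.

(** Using [i_succ i] rather than [i] makes every modulus, including that of index 0, exceed 1 when
    [m] is nonzero. *)
Definition modulus (m i : M) : M := i_succ (i_succ i * m).

Lemma modulus_not_divides_one m i : m <> 0 -> ~ divides (modulus m i) 1.
Proof.
  intros Hm H. destruct (zero_or_succ m) as [|[n ->]]; [contradiction|].
  apply (@succ_ne_zero 0). revert H.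
  apply (@divides_lt _ _ (n + i * i_succ n)). unfold modulus.
  now rewrite mul_succ_l, !add_succ_l, add_zero_l.
Qed.

(** Subtract [m * z * i_succ i], a multiple of the modulus by hypothesis, from [modulus m i * z];
    what remains is [z]. *)
Lemma coprime_modulus_self m i : coprime (modulus m i) m.
Proof.
  intros z H. apply (@divides_add_cancel _ (m * z * i_succ i)).
  - exists z. unfold modulus. rewrite (succ_eq (_ * _)). ring.
  - now apply divides_mul_r.
Qed.

(** The two moduli differ by [i_succ l * m], so [modulus m i] divides [i_succ l * m * z].
    Multiplying by the cofactor of [i_succ l] in [m] gives [m * (m * z)], and [m] cancels twice. *)
Lemma coprime_modulus m i j l :
  divides (i_succ l) m -> (j = i + i_succ l \/ i = j + i_succ l) ->
  coprime (modulus m i) (modulus m j).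
Proof.
  intros [t Ht] Hij z H.
  apply (coprime_modulus_self (m := m)), (coprime_modulus_self (m := m)).
  assert (Hl : divides (modulus m i) (i_succ l * m * z)).
  { destruct Hij as [-> | ->].
    - apply (@divides_add_cancel _ (modulus m i * z)).
      + destruct H as [q Hq]. exists q. rewrite <- Hq. unfold modulus.
        rewrite !(succ_eq (_ * _)), (succ_eq (_ + _)), (succ_eq i). ring.
      + now exists z.
    - eapply divides_add_cancel; [|exact H].
      exists z. unfold modulus.
      rewrite !(succ_eq (_ * _)), (succ_eq (_ + _)), (succ_eq j). ring. }
  apply (divides_mul_r t) in Hl.
  replace (m * (m * z)) with (i_succ l * m * z * t); [exact Hl|].
  rewrite Ht at 2. ring.
Qed.

(** The witness built by induction is the factorial of [k]. *)
Lemma common_multiple k :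
  exists m, m <> 0 /\ forall j s, k = i_succ (j + s) -> divides (i_succ j) m.
Proof.
  revert k.
  apply (@model_induction
           (Ex (And (Neg (Eq (var 0) Zero))
              (All (All (Imp (Eq (var 3) (Succ (Plus (var 1) (var 0))))
                 (Ex (Eq (var 3) (Mult (Succ (var 2)) (var 0)))))))))
           env0); cbn.
  - exists 1. split; [apply succ_ne_zero|].
    intros j s H. symmetry in H. now apply succ_ne_zero in H.
  - intros k (m & Hm & Hdiv). exists (i_succ k * m). split.
    + rewrite mul_succ_l, add_comm. now intros H%add_eq_zero_r.
    + intros j s H%succ_inj. destruct (zero_or_succ s) as [->|[s' ->]].
      * rewrite add_zero_r in H. subst k. now exists m.
      * rewrite add_succ_r in H. destruct (Hdiv j s' H) as [t ->].
        exists (i_succ k * t). ring.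
Qed.

Definition codes (P : M -> Prop) (m k c : M) : Prop :=
  forall i s, k = i_succ (i + s) -> P i <-> divides (modulus m i) c.

(** The code is the product of the moduli at those [i] below [k] where the predicate holds. The
    induction is strengthened by coprimality to the moduli from [k] up to [e], and the double
    negation lies inside the induction formula because the predicate need not be decidable. *)
Lemma coding_partial (phi : form) (rho : nat -> M) (e m : M) :
  m <> 0 -> (forall j s, e = i_succ (j + s) -> divides (i_succ j) m) ->
  forall k w, e = k + w -> ~ ~ exists c,
    codes (fun i => sat (scons i rho) phi) m k c /\
    forall u s, e = i_succ (k + u + s) -> coprime (modulus m (k + u)) c.
Proof.
  intros Hm Hdiv. unfold codes. set (P := fun i => sat (scons i rho) phi).
  (* [F] below expresses the statement about [k] in the environment k, e, m,
     rho; its only occurrence of [phi'] is under the binders w, c, i, s. *)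
  pose (phi' := subst_form (scons (var 1) (fun n => var (7 + n)%nat)) phi).
  assert (Hphi' : forall s i c w k,
    sat (scons s (scons i (scons c (scons w (scons k (scons e (scons m rho))))))) phi'
      <-> P i).
  { intros. unfold phi'. rewrite sat_subst. apply sat_ext. now intros [|n]. }
  pose (F := All (Imp (Eq (var 2) (Plus (var 1) (var 0))) (Neg (Neg (Ex (And
    (All (All (Imp (Eq (var 4) (Succ (Plus (var 1) (var 0))))
      (Iff phi' (Ex (Eq (var 3) (Mult (Succ (Mult (Succ (var 2)) (var 7))) (var 0))))))))
    (All (All (Imp (Eq (var 5) (Succ (Plus (Plus (var 4) (var 1)) (var 0))))
      (All (Imp
        (Ex (Eq (Mult (var 4) (var 1))
          (Mult (Succ (Mult (Succ (Plus (var 6) (var 3))) (var 8))) (var 0))))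
        (Ex (Eq (var 1)
          (Mult (Succ (Mult (Succ (Plus (var 6) (var 3))) (var 8))) (var 0))))))))))))))).
  assert (HF : forall k, sat (scons k (scons e (scons m rho))) F <->
    forall w, e = k + w -> ~ ~ exists c,
      (forall i s, k = i_succ (i + s) -> P i <-> divides (modulus m i) c) /\
      forall u s, e = i_succ (k + u + s) -> coprime (modulus m (k + u)) c).
  { intros k. cbn -[phi']. setoid_rewrite Hphi'. reflexivity. }
  intros k. apply HF. revert k. apply model_induction.
  - apply HF. intros w _ H. apply H. exists 1. split.
    + intros i s H0. symmetry in H0. now apply succ_ne_zero in H0.
    + intros. apply coprime_one.
  - intros k IH. apply HF. intros w He Hno. rewrite HF in IH.
    rewrite add_succ_l in He.
    apply (IH (i_succ w)); [now rewrite add_succ_r|]. intros (c & Hcode & Hcop).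
    assert (Hcop' : forall u s, e = i_succ (i_succ k + u + s) ->
      coprime (modulus m (i_succ k + u)) c).
    { intros u s.
      replace (i_succ k + u) with (k + i_succ u) by now rewrite add_succ_l, add_succ_r.
      apply Hcop. }
    (* The goal is [False], so excluded middle for [P k] may be used. *)
    assert (HPk : ~ ~ (P k \/ ~ P k)) by tauto.
    apply HPk. intros [Hk|Hk]; apply Hno.
    + exists (c * modulus m k). split.
      * intros i s Hi%succ_inj. destruct (zero_or_succ s) as [->|[s' ->]].
        -- rewrite add_zero_r in Hi. subst i. split; [intros _|easy].
           exists c. ring.
        -- assert (Hi' : k = i_succ (i + s')) by now rewrite <- add_succ_r.
           rewrite (Hcode i s' Hi'). split; [apply divides_mul_r|].
           (* The new factor is coprime to the earlier moduli, so it leaves the earlier bits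
              unchanged. *)
           rewrite mul_comm. apply (@coprime_modulus _ _ _ s'); [|now left].
           apply (Hdiv _ (i_succ i + w)). rewrite He, Hi'.
           rewrite !(succ_eq (_ + _)), (succ_eq i). ring.
      * intros u s Hu. apply coprime_mul; [now apply (Hcop' u s)|].
        apply (@coprime_modulus _ _ _ u).
        -- apply (Hdiv _ (i_succ k + s)). rewrite Hu. f_equal. ring.
        -- right. now rewrite add_succ_l, add_succ_r.
    + exists c. split; [|exact Hcop'].
      intros i s Hi%succ_inj. destruct (zero_or_succ s) as [->|[s' ->]].
      * rewrite add_zero_r in Hi. subst i. split; [easy|intros Hc].
        (* The modulus at [k] is coprime to [c]; if it divided [c], it would divide 1. *)
        exfalso. apply (@modulus_not_divides_one m k Hm).
        assert (Hk0 : coprime (modulus m k) c).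
        { rewrite <- (add_zero_r k). apply (Hcop 0 w).
          now rewrite add_zero_r. }
        apply Hk0. replace (c * 1) with c by ring. exact Hc.
      * apply (Hcode i s'). now rewrite <- add_succ_r.
Qed.

Lemma coding (phi : form) (rho : nat -> M) (e : M) :
  ~ ~ exists m c, codes (fun i => sat (scons i rho) phi) m e c.
Proof.
  destruct (common_multiple e) as (m & Hm & Hdiv). intros Hno.
  apply (coding_partial (phi := phi) (rho := rho) Hm Hdiv (k := e) (w := 0)).
  - now rewrite add_zero_r.
  - intros (c & Hc & _). apply Hno. now exists m, c.
Qed.

(** * Standard elements *)

Definition numeral (n : nat) : M := eval env0 (num n).

Lemma eval_num (rho : nat -> M) n : eval rho (num n) = numeral n.
Proof.
  unfold numeral. induction n as [|n IH]; cbn; congruence.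
Qed.

Lemma numeral_homomorphism : homomorphism_from_nat numeral.
Proof.
  assert (Hadd : forall n n', numeral (n + n') = numeral n + numeral n').
  { intros n n'. induction n as [|n IH].
    - symmetry. apply add_zero_l.
    - change (i_succ (numeral (n + n')) = i_succ (numeral n) + numeral n').
      now rewrite IH, add_succ_l. }
  repeat split; [exact Hadd|].
  intros n n'. induction n as [|n IH].
  - symmetry. apply mul_zero_l.
  - change (numeral (n' + n * n') = i_succ (numeral n) * numeral n').
    now rewrite Hadd, IH, mul_succ_l.
Qed.

Lemma numeral_injective : Injective numeral.
Proof.
  intros n. induction n as [|n IH]; intros [|k] H.
  - reflexivity.
  - symmetry in H. now apply succ_ne_zero in H.
  - now apply succ_ne_zero in H.
  - f_equal. apply IH. now apply succ_inj.
Qed.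

(** The gap from a numeral up to [e] is never 0, so it can always be shortened by one. *)
Lemma numeral_lt_nonstandard e :
  (forall n, numeral n <> e) -> forall n, exists s, e = i_succ (numeral n + s).
Proof.
  intros He n. induction n as [|n [s Hs]].
  - destruct (zero_or_succ e) as [->|[s ->]]; [now destruct (He O)|].
    exists s. cbn. now rewrite add_zero_l.
  - destruct (zero_or_succ s) as [->|[s' ->]].
    + destruct (He (S n)). now rewrite Hs, add_zero_r.
    + exists s'. rewrite Hs, add_succ_r. cbn. now rewrite add_succ_l.
Qed.

Lemma sat_Q (rho : nat -> M) (phi : form) : In phi Q -> sat rho phi.
Proof.
  intros [<-|H].
  - exact zero_or_succ.
  - now apply hHA, HA_base.
Qed.

(** The constant environment fixes the output variable at 1, turning [phi] into a predicate of its
    argument alone, the form that [coding] expects. *)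
Lemma represents_sat (phi : form) (n v : nat) :
  prv Q (All (Iff (inst (num n) phi) (Eq (num v) (var 0)))) ->
  sat (scons (numeral n) (fun _ => numeral 1)) phi <-> v = 1%nat.
Proof.
  intros Hprv.
  pose proof (soundness Hprv (@sat_Q (fun _ => numeral 1)) (numeral 1)) as H.
  cbn [sat Iff] in H. rewrite sat_inst, !eval_num in H.
  assert (Hext : sat (scons (numeral n) (fun _ => numeral 1)) phi <->
    sat (scons (numeral n) (scons (numeral 1) (fun _ => numeral 1))) phi).
  { apply sat_ext. now intros [|[|k]]. }
  rewrite Hext. cbn in H. split.
  - intros Hs. apply numeral_injective. now apply H.
  - intros ->. now apply H.
Qed.

Lemma nonstandard_codes (ct : CT_Q) (e : M) (D : nat -> bool) :
  (forall n, numeral n <> e) ->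
  ~ ~ exists m c, forall n, D n = true <-> divides (modulus m (numeral n)) c.
Proof.
  intros He Hno. destruct (ct (fun n => if D n then 1%nat else O)) as (phi & _ & _ & Hphi).
  apply (coding (phi := phi) (rho := fun _ => numeral 1) (e := e)).
  intros (m & c & Hc). apply Hno. exists m, c. intros n.
  destruct (numeral_lt_nonstandard He n) as [s Hs].
  rewrite <- (Hc _ s Hs), (represents_sat (Hphi n)).
  now destruct (D n).
Qed.

(** * Deciding divisibility *)

Section Enumerable.

Context (eqM : forall x y : M, {x = y} + {x <> y}).
Context (g : nat -> option M) (hg : forall x, exists n, g n = Some x).

(** The default 0 is harmless, since only surjectivity matters. *)
Definition enum (n : nat) : M := match g n with Some x => x | None => 0 end.

Lemma enum_surj x : exists n, enum n = x.
Proof.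
  destruct (hg x) as [n Hn]. exists n. unfold enum. now rewrite Hn.
Qed.

(* Searching for a quotient alone would only semi-decide divisibility; the
   search for a remainder always terminates. *)
Lemma divides_dec p c : {divides (i_succ p) c} + {~ divides (i_succ p) c}.
Proof.
  (* Each [n] encodes a quotient, a remainder and the slack bounding the remainder, by nested Cantor
     pairing. *)
  pose (q n := enum (fst (of_nat n))).
  pose (r n := enum (fst (of_nat (snd (of_nat n))))).
  pose (s n := enum (snd (of_nat (snd (of_nat n))))).
  destruct (constructive_indefinite_ground_description_nat
    (fun n => c = i_succ p * q n + r n /\ i_succ p = i_succ (r n + s n)))
    as [n [Hc Hp]].
  - intros n. destruct (eqM c (i_succ p * q n + r n)); [|right; tauto].
    destruct (eqM (i_succ p) (i_succ (r n + s n))); [left|right]; tauto.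
  - destruct (division p c) as (x & y & z & H).
    destruct (enum_surj x) as [i <-], (enum_surj y) as [j <-], (enum_surj z) as [k <-].
    exists (to_nat (i, to_nat (j, k))). unfold q, r, s.
    repeat (rewrite cancel_of_to; cbn [fst snd]). exact H.
  (* A zero remainder exhibits a quotient; a nonzero one lies below the divisor and so is not
     divisible by it. *)
  - destruct (eqM (r n) 0) as [H0|H0].
    + left. exists (q n). rewrite Hc at 1. rewrite H0. apply add_zero_r.
    + right. intros H. apply H0, (divides_lt Hp).
      apply (@divides_add_cancel _ (i_succ p * q n)); [now rewrite <- Hc|].
      now exists (q n).
Qed.

Lemma not_nonstandard (ct : CT_Q) (e : M) : ~ (forall n, numeral n <> e).
Proof.
  intros He.
  (* Reading [n] as a pair [(m, c)], the divisor tested is exactly [modulus m (numeral n)], and [D]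
     flips the answer. *)
  pose (D n := if divides_dec (i_succ (numeral n) * enum (fst (of_nat n)))
                 (enum (snd (of_nat n))) then false else true).
  apply (nonstandard_codes ct (D := D) He). intros (m & c & Hmc).
  destruct (enum_surj m) as [i Hi], (enum_surj c) as [j Hj].
  specialize (Hmc (to_nat (i, j))). unfold D in Hmc.
  rewrite cancel_of_to in Hmc. cbn [fst snd] in Hmc. rewrite Hi, Hj in Hmc.
  destruct divides_dec as [H|H].
  - discriminate (proj2 Hmc H).
  - exact (H (proj1 Hmc eq_refl)).
Qed.

End Enumerable.
End Model.

Theorem theorem7p5 (ct : CT_Q) (mp : MP) (M : structure)
  (hHA : model_of_HA M) (hdiscrete : discrete M) (henum : enumerable M) :
  iso_nat M.
Proof.
  destruct hdiscrete as [f Hf], henum as [g Hg].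
  assert (eqM : forall x y : M, {x = y} + {x <> y}).
  { intros x y. destruct (f x y) eqn:E; [left|right].
    - now apply Hf.
    - intros H%Hf. congruence. }
  exists (numeral M). split; [|split].
  - now apply numeral_homomorphism.
  - now apply numeral_injective.
  - intros e.
    (* Decidable equality gives a function vanishing exactly where the numeral of [n] is [e], as
       Markov's principle requires. *)
    destruct (mp (fun n => if eqM (numeral M n) e then 0 else 1)) as [n Hn].
    + intros Hno. apply (not_nonstandard hHA eqM Hg ct (e := e)).
      intros n Hn. apply Hno. exists n. now destruct eqM.
    + exists n. now destruct (eqM (numeral M n) e).
Qed.
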